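(* Let $K$ be a compact space and $\kappa$ a cardinal. Let $\{U_\alpha:\alpha<\kappa\}$ be a family of pairwise disjoint non-empty clopen subsets of $K$ such that each $U_\alpha$ admits a Cantor scheme of clopen subsets. Assume that $\mathcal{P}$ is a family of compact subsets of $\mathbb{R}$ such that $\{0\}\notin\mathcal{P}$ and there is $P\in\mathcal{P}$ with the property that $\bigcup_{i\in\mathbb{N}}c_iP\cup\{0\}\in\mathcal{P}$ for every non-zero sequence $(c_n)_{n\in\mathbb{N}}$ of real numbers tending to zero. Then the set $$\{f\in C(K):\operatorname{rng}(f)\in\mathcal{P}\}\cup\{0\}$$ contains an isometric copy of $c_0(\kappa)$.
   Context: $C(K)$ is the Banach space of real-valued continuous functions on $K$ with the supremum norm; $\operatorname{rng}(f)=f(K)$. A Cantor scheme in a non-empty set $X$ is a family $\{A_s:s\in\{0,1\}^{<\mathbb{N}}\}$ of non-empty subsets of $X$ indexed by finite 0-1 sequences such that (i) $A_\emptyset=X$, where $\emptyset$ is the empty sequence; (ii) $A_{s\hat{\ }i}\subseteq A_s$ for every $s$ and $i=0,1$, where $s\hat{\ }i$ is $s$ extended by $i$; (iii) $A_{s\hat{\ }0}\cap A_{s\hat{\ }1}=\emptyset$ for every $s$. A set $U_\alpha$ admits a Cantor scheme of clopen subsets if there is a Cantor scheme in $X=U_\alpha$ all of whose members are clopen. A non-zero sequence is one that is not identically zero (some terms may be $0$); $cP=\{cp:p\in P\}$. For a cardinal $\kappa$, $c_0(\kappa)=\{x\in\mathbb{R}^\kappa : \{\alpha<\kappa : |x(\alpha)|>\varepsilon\}\text{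 is finite for every }\varepsilon>0\}$, with the supremum norm. An isometric copy of a Banach space $Z$ in $C(K)$ means a linear subspace of $C(K)$ which is the image of $Z$ under a linear isometry. *)

(* Defs.v *)
From HB Require Import structures.
From mathcomp Require Import all_boot all_order all_algebra.
From mathcomp Require Import all_classical all_reals all_analysis.
Set Implicit Arguments.
Unset Strict Implicit.
Unset Printing Implicit Defensive.
Import Order.TTheory GRing.Theory Num.Theory.
Import numFieldNormedType.Exports.
Local Open Scope classical_set_scope.
Local Open Scope ring_scope.

(* [sup set0 = 0], so this is also the right norm when [T] is empty. *)
Definition supnorm (R : realType) (T : Type) (f : T -> R) : R :=
  sup (range (fun t => `|f t|)).

Definition bounded_on (R : realType) (T : Type) (f : T -> R) : Prop :=
  exists M : R, forall t, `|f t| <= M.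

Lemma supnorm_ub (R : realType) (T : Type) (f : T -> R) (t : T) :
  bounded_on f -> `|f t| <= supnorm f.
Proof.
by move=> [M fM]; apply: ub_le_sup; [exists M => _ [s _ <-]|exists t].
Qed.

Lemma supnorm_le (R : realType) (T : Type) (f : T -> R) (M : R) :
  0 <= M -> (forall t, `|f t| <= M) -> supnorm f <= M.
Proof.
move=> M0 fM; have [E|/set0P ne] := eqVneq (range (fun t => `|f t|)) set0.
  by rewrite /supnorm E sup0.
by apply: ge_sup => // _ [t _ <-].
Qed.

Lemma supnorm_ge0 (R : realType) (T : Type) (f : T -> R) :
  bounded_on f -> 0 <= supnorm f.
Proof.
move=> bf; have [E|/set0P[_ [t _ _]]] := eqVneq (range (fun t => `|f t|)) set0.
  by rewrite /supnorm E sup0.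
exact: le_trans (supnorm_ub t bf).
Qed.

Lemma supnormD (R : realType) (T : Type) (f g : T -> R) :
  bounded_on f -> bounded_on g ->
  supnorm (f + g) <= supnorm f + supnorm g.
Proof.
move=> bf bg; apply: supnorm_le => [|t]; first by rewrite addr_ge0 ?supnorm_ge0.
by rewrite (le_trans (ler_normD _ _))// lerD// supnorm_ub.
Qed.

Lemma bounded_onZ (R : realType) (T : Type) (a : R) (f : T -> R) :
  bounded_on f -> bounded_on (a *: f).
Proof.
move=> [M fM]; exists (`|a| * M) => t.
by rewrite [(a *: f) t]/(a * f t) normrM ler_wpM2l.
Qed.

Lemma supnormZ (R : realType) (T : Type) (a : R) (f : T -> R) :
  bounded_on f -> supnorm (a *: f) = `|a| * supnorm f.
Proof.
move=> bf; have le b g : bounded_on g -> supnorm (b *: g) <= `|b| * supnorm g.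
  move=> bg; apply: supnorm_le => [|t]; first by rewrite mulr_ge0 ?supnorm_ge0.
  by rewrite [(b *: g) t]/(b * g t) normrM ler_wpM2l// supnorm_ub.
apply/eqP; rewrite eq_le le//=.
have [->|a0] := eqVneq a 0.
  by rewrite normr0 mul0r scale0r -(scale0r f) supnorm_ge0//; exact: bounded_onZ.
rewrite -{1}[f](scalerK a0) -ler_pdivlMl ?normr_gt0// -normfV.
by apply: le; exact: bounded_onZ.
Qed.

Lemma supnorm_eq0 (R : realType) (T : Type) (f : T -> R) :
  bounded_on f -> supnorm f = 0 -> f = 0.
Proof.
move=> bf f0; apply/funext => t; apply/eqP.
by rewrite -normr_le0 -f0 supnorm_ub.
Qed.

Definition continuous_pred (R : realType) (K : topologicalType) :
  {pred K -> R} := mem [set f : K -> R | continuous f].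

Lemma continuous_submod_closed (R : realType) (K : topologicalType) :
  submod_closed (@continuous_pred R K).
Proof.
split; first by rewrite inE => x; exact: cvg_cst.
move=> a f g; rewrite !inE => cf cg x.
by apply: cvgD; [apply: cvgZr; exact: cf|exact: cg].
Qed.

HB.instance Definition _ (R : realType) (K : topologicalType) :=
  GRing.isSubmodClosed.Build R (K -> R) (@continuous_pred R K)
    (@continuous_submod_closed R K).

(* The compactness proof is a parameter of the type because the supremum norm
   is only a norm on C(K) when every continuous function is bounded. *)
Record contfun (R : realType) (K : topologicalType)
    (cK : compact [set: K]) : Type := ContFun {
  contfun_val :> K -> R;
  contfunP : contfun_val \in @continuous_pred R K }.

HB.instance Definition _ (R : realType) (K : topologicalType)
  (cK : compact [set: K]) := [isSub for @contfun_val R K cK].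
HB.instance Definition _ (R : realType) (K : topologicalType)
  (cK : compact [set: K]) := [Choice of contfun R cK by <:].
HB.instance Definition _ (R : realType) (K : topologicalType)
  (cK : compact [set: K]) := [SubChoice_isSubLmodule of contfun R cK by <:].

Lemma contfun_bounded (R : realType) (K : topologicalType)
  (cK : compact [set: K]) (f : contfun R cK) : bounded_on f.
Proof.
have cf : continuous f by have := contfunP f; rewrite inE.
have [M [_ fM]] : bounded_set (range f).
  apply: compact_bounded; apply: continuous_compact => //.
  exact: continuous_subspaceT.
by exists (M + 1) => t; apply: (fM (M + 1)); [rewrite ltrDl|exists t].
Qed.

Lemma contfun_norm0 (R : realType) (K : topologicalType)
  (cK : compact [set: K]) (f : contfun R cK) : supnorm f = 0 -> f = 0.
Proof. by move=> /(supnorm_eq0 (contfun_bounded f)) f0; exact: val_inj. Qed.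

HB.instance Definition _ (R : realType) (K : topologicalType)
    (cK : compact [set: K]) :=
  Lmodule_isNormed.Build R (contfun R cK)
    (norm := fun f => supnorm (f : K -> R))
    (fun f g => supnormD (contfun_bounded f) (contfun_bounded g))
    (fun a f => supnormZ a (contfun_bounded f))
    (@contfun_norm0 R K cK).

Definition c0_pred (R : realType) (I : Type) : {pred I -> R} :=
  mem [set x : I -> R |
        forall e : R, 0 < e -> finite_set [set i | e < `|x i|]].

Lemma c0_submod_closed (R : realType) (I : Type) :
  submod_closed (@c0_pred R I).
Proof.
split.
  rewrite inE => e e0; apply: (sub_finite_set _ (finite_set0 _)) => i /=.
  by rewrite normr0 => /(lt_trans e0); rewrite ltxx.
move=> a x y; rewrite !inE => cx cy e e0.
have a1 : 0 < `|a| + 1 by rewrite ltr_wpDl.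
apply: (sub_finite_set (B :=
  [set i | e / 2 / (`|a| + 1) < `|x i|] `|` [set i | e / 2 < `|y i|])); last first.
  by rewrite finite_setU; split; [apply: cx|apply: cy]; rewrite !divr_gt0.
move=> i /= ei; have [yi|yi] := ltP (e / 2) `|y i|; [by right|left].
rewrite ltr_pdivrMr//.
have h : e / 2 < `|a| * `|x i|.
  rewrite -normrM -(ltrD2r (e / 2)) -splitr (lt_le_trans ei)//.
  by rewrite (le_trans (ler_normD _ _))// lerD2l.
by rewrite (lt_le_trans h)// mulrC ler_wpM2l// lerDl.
Qed.

HB.instance Definition _ (R : realType) (I : Type) :=
  GRing.isSubmodClosed.Build R (I -> R) (@c0_pred R I)
    (@c0_submod_closed R I).

(* c_0(kappa), for any index type [I] of cardinality kappa. *)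
Record c0 (R : realType) (I : Type) : Type := C0 {
  c0_val :> I -> R;
  c0P : c0_val \in @c0_pred R I }.

HB.instance Definition _ (R : realType) (I : Type) := [isSub for @c0_val R I].
HB.instance Definition _ (R : realType) (I : Type) := [Choice of c0 R I by <:].
HB.instance Definition _ (R : realType) (I : Type) :=
  [SubChoice_isSubLmodule of c0 R I by <:].

Lemma c0_bounded (R : realType) (I : Type) (x : c0 R I) : bounded_on x.
Proof.
have fx : finite_set [set i | 1 < `|x i|].
  by have := c0P x; rewrite inE => /(_ _ ltr01).
have [M [_ xM]] : bounded_set [set x i | i in [set i | 1 < `|x i|]].
  exact/compact_bounded/finite_compact/finite_image.
exists (Num.max 1 (M + 1)) => i.
have [xi|xi] := ltP 1 `|x i|; last by rewrite le_max xi.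
by rewrite le_max (xM (M + 1)) ?orbT ?ltrDl//; exists i.
Qed.

Lemma c0_norm0 (R : realType) (I : Type) (x : c0 R I) : supnorm x = 0 -> x = 0.
Proof. by move=> /(supnorm_eq0 (c0_bounded x)) x0; exact: val_inj. Qed.

HB.instance Definition _ (R : realType) (I : Type) :=
  Lmodule_isNormed.Build R (c0 R I)
    (norm := fun x => supnorm (x : I -> R))
    (fun x y => supnormD (c0_bounded x) (c0_bounded y))
    (fun a x => supnormZ a (c0_bounded x))
    (@c0_norm0 R I).

(* Finite 0-1 sequences are [seq bool]; [rcons s i] is s extended by i. *)
Definition cantor_scheme (T : Type) (X : set T) (A : seq bool -> set T) : Prop :=
  [/\ forall s, A s !=set0,
      A [::] = X,
      forall s i, A (rcons s i) `<=` A s &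
      forall s, A (rcons s false) `&` A (rcons s true) = set0].

Definition admits_clopen_cantor_scheme (K : topologicalType) (U : set K) : Prop :=
  exists A : seq bool -> set K, cantor_scheme U A /\ forall s, clopen (A s).

Definition isometric_copy (R : numFieldType) (Z V : normedModType R)
    (S : set V) : Prop :=
  exists T : {linear Z -> V}, (forall z : Z, `|T z| = `|z|) /\ S = range T.

Arguments isometric_copy {R} Z {V} S.

(* Main.v *)
(* A clopen Cantor scheme on U gives a continuous map from K to the Cantor space
   which is onto already on U, and by the Alexandroff-Hausdorff theorem the
   Cantor space maps onto every non-empty compact subset of R.  With
   m in P of maximal modulus this yields, for each a, a continuous h_a : K -> R with
   h_a(U_a) = m^-1 (P u {0}), so that |h_a| has maximum 1 on U_a.  The map
   sending x in c_0(kappa) to the function equal to x(a) h_a on each U_a and to 0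
   elsewhere is then a linear isometry.  As x has countable support, enumerated
   by a null sequence (c_i), the range of its image is the union of the
   m^-1 c_i P and {0}. *)
Require Import Defs.
From HB Require Import structures.
From mathcomp Require Import all_boot all_order all_algebra.
From mathcomp Require Import all_classical all_reals all_analysis.
Import Order.TTheory GRing.Theory Num.Theory.
Import numFieldNormedType.Exports.
Local Open Scope classical_set_scope.
Local Open Scope ring_scope.

(** * Compact subsets of the line as images of the Cantor space *)

Lemma set_type_compact (X : topologicalType) (A : set X) :
  compact A -> compact [set: set_type A].
Proof.
move=> cA F PF _.
have FA : (set_val @ F) A.
  by rewrite /nbhs/=; apply: filterS filterT => y _; exact: set_valP.
have [p [Ap clp]] := cA (set_val @ F) _ FA.
exists (exist _ p (mem_set Ap)); split=> // B C FB [_ [[W oW <-] Wp] WC].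
have FB' : (set_val @ F) (set_val @` B).
  by rewrite /nbhs/=; apply: filterS FB => y By; exists y.
have [_ [[y By <-] Wy]] := clp _ _ FB' (open_nbhs_nbhs (conj oW Wp)).
by exists y; split=> //; exact: WC.
Qed.

Lemma set_type_hausdorff (X : topologicalType) (A : set X) :
  hausdorff_space X -> hausdorff_space (set_type A).
Proof.
move=> hX x y clxy; apply: val_inj; apply: hX => B C nB nC.
have [z [? ?]] := clxy _ _ (initial_continuous nB) (initial_continuous nC).
by exists (set_val z).
Qed.

Lemma cantor_onto_compact (R : realType) (Q : set R) :
  compact Q -> Q !=set0 ->
  exists2 f : cantor_space -> R, continuous f & range f = Q.
Proof.
move=> cQ [q Qq].
(* Alexandroff-Hausdorff is applied to the subtype, with [q] as its base point. *)
pose T : pseudoPMetricType R := HB.pack (set_type Q)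
  (isPointed.Build (set_type Q) (exist _ q (mem_set Qq))).
have cT : compact [set: T] := @set_type_compact _ Q cQ.
have hT : hausdorff_space T := @set_type_hausdorff _ Q (@Rhausdorff R).
have [f cf] := cantor_surj cT hT.
exists (fun s => set_val (f s : set_type Q)).
  by move=> s; apply: continuous_comp; [exact: cf|exact: initial_continuous].
apply/seteqP; split=> [_ [s _ <-]|r Qr]; first exact: set_valP.
have [s _ fs] := @surj _ _ _ _ f (exist _ r (mem_set Qr)) I.
by exists s => //; rewrite fs.
Qed.

(** * Coding points by a clopen Cantor scheme *)

Section scheme.
Context {K : topologicalType} {U : set K} {A : seq bool -> set K}.
Hypotheses (sA : cantor_scheme U A) (clA : forall s, clopen (A s)).

(** Induction on the last digit: the parents agree because members shrink along extensions, the last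
    digits because siblings are disjoint. *)
Lemma cantor_scheme_inj (s t : seq bool) (x : K) :
  size s = size t -> A s x -> A t x -> s = t.
Proof.
have [_ _ subA disjA] := sA.
elim/last_ind: s t => [|s i IH] t; first by move/esym/size0nil.
case/lastP: t => [|t j]; first by rewrite size_rcons.
rewrite !size_rcons => -[st] Ai Aj.
have est := IH t st (subA _ _ _ Ai) (subA _ _ _ Aj); subst t; congr rcons.
by move: i j Ai Aj => [] [] // Ai Aj; have : set0 x by rewrite -(disjA s).
Qed.

(* The two successors of a member of the scheme need not cover it, so the n-th
   digit of a point is read off from all members of level n+1 ending in 1. *)
Definition scheme_digit (n : nat) : set K :=
  \bigcup_(s in [set: n.-tuple bool]) A (rcons s true).

Lemma clopen_scheme_digit n : clopen (scheme_digit n).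
Proof.
split; first by apply: bigcup_open => s _; have [] := clA (rcons s true).
apply: closed_bigcup => [|s _]; last by have [] := clA (rcons s true).
exact: finite_finset.
Qed.

Definition scheme_code (x : K) : cantor_space := fun n => `[< scheme_digit n x >].

(** Continuity is tested coordinatewise, and each digit is locally constant because its digit set is
    clopen. *)
Lemma scheme_code_continuous : continuous scheme_code.
Proof.
move=> x; apply/cvg_sup => n.
apply: continuous_comp_initial => {}x B /nbhs_singleton/= Bx.
have [oD cD] := clopen_scheme_digit n.
have [Dx|Dx] := pselect (scheme_digit n x).
  apply: filterS (open_nbhs_nbhs (conj oD Dx)) => y Dy /=.
  by move: Bx; rewrite /scheme_code/= (asboolT Dx) (asboolT Dy).
apply: filterS (open_nbhs_nbhs (conj (closed_openC cD) Dx)) => y Dy /=.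
by move: Bx; rewrite /scheme_code/= (asboolF Dx) (asboolF Dy).
Qed.

(** The members along [c] are nested, non-empty and closed; a cluster point of the filter they
    generate lies in all of them. *)
Lemma cantor_scheme_branch (c : nat -> bool) :
  compact [set: K] -> exists x, forall n, A (mkseq c n) x.
Proof.
have [neA _ subA _] := sA => cK.
have sub m n : (m <= n)%N -> A (mkseq c n) `<=` A (mkseq c m).
  elim: n => [|n IH]; first by rewrite leqn0 => /eqP ->.
  rewrite leq_eqVlt => /predU1P[-> //|/IH]; apply: subset_trans.
  by rewrite mkseqS; exact: subA.
have PF : ProperFilter (filter_from [set: nat] (fun n => A (mkseq c n))).
  apply: filter_from_proper => [|n _]; last exact: neA.
  apply: filter_from_filter => [|m n _ _]; first by exists 0%N.
  exists (maxn m n) => // x Ax.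
  by split; apply: sub Ax; rewrite ?leq_maxl ?leq_maxr.
have [x [_ clx]] := cK _ PF filterT.
exists x => n; have [_ /closure_id ->] := clA (mkseq c n).
by move=> B nB; apply: clx => //; exists n.
Qed.

Lemma scheme_code_surj : compact [set: K] -> scheme_code @` U = [set: cantor_space].
Proof.
move=> cK; have [_ A0 _ _] := sA.
apply/seteqP; split=> // c _; have [x Ax] := cantor_scheme_branch c cK.
exists x; first by rewrite -A0; exact: Ax 0%N.
apply/funext => n; rewrite /scheme_code; have := Ax n.+1; rewrite mkseqS.
case cn : (c n) => Acx.
  apply/asboolT; have sz : size (mkseq c n) == n by rewrite size_mkseq.
  by exists (Tuple sz).
(* Here [x] lies in a member of level n+1 ending in 0, hence in none of that level ending in 1. *)
apply/asboolF => -[s _ /(cantor_scheme_inj _ _ _ _ Acx)].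
rewrite !size_rcons size_mkseq size_tuple => /(_ erefl)/rcons_inj[] //.
Qed.

End scheme.

(** The code is defined on all of [K], so composing it with a surjection onto [Q] stays in [Q]
    everywhere and already exhausts [Q] on [U]. *)
Lemma scheme_onto_compact (R : realType) (K : topologicalType) (U : set K)
    (Q : set R) :
  compact [set: K] -> admits_clopen_cantor_scheme U -> compact Q -> Q !=set0 ->
  exists f : K -> R, [/\ continuous f, forall t, Q (f t) & Q `<=` f @` U].
Proof.
move=> cK [A [sA clA]] cQ Q0.
have [g cg gQ] := cantor_onto_compact _ _ cQ Q0.
exists (g \o @scheme_code _ A); split.
- move=> x; apply: continuous_comp; last exact: cg.
  exact: scheme_code_continuous.
- by move=> t; rewrite -gQ; exists (scheme_code (A := A) t).
move=> q; rewrite -gQ => -[c _ <-].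
have : [set: cantor_space] c by [].
by rewrite -(scheme_code_surj sA clA cK) => -[x Ux <-]; exists x.
Qed.

(** * Gluing scaled functions along disjoint clopen sets *)

Section glue.
Context {R : realType} {K : topologicalType} {kappa : Type}.
Context {U : kappa -> set K} (h : kappa -> K -> R).
Hypothesis U_disj : forall a b : kappa, a <> b -> U a `&` U b = set0.

Definition glue (x : kappa -> R) (t : K) : R :=
  if pselect (exists a, U a t) is left e
  then x (sval (cid e)) * h (sval (cid e)) t else 0.

Lemma glue_in (x : kappa -> R) (a : kappa) (t : K) :
  U a t -> glue x t = x a * h a t.
Proof.
move=> Ut; rewrite /glue; case: pselect => [e|[]]; last by exists a.
case: (cid e) => b Ubt /=; have [->//|ba] := pselect (b = a).
by have : set0 t by rewrite -(U_disj _ _ ba).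
Qed.

Lemma glue_out (x : kappa -> R) (t : K) :
  (forall a, ~ U a t) -> glue x t = 0.
Proof. by move=> nU; rewrite /glue; case: pselect => // e; have [a /nU] := e. Qed.

(** The index chosen at [t] does not depend on the coefficients, so all three values of [glue] use
    the same one. *)
Lemma glue_linear (c : R) (x y : kappa -> R) (t : K) :
  glue (c *: x + y) t = c * glue x t + glue y t.
Proof.
rewrite /glue; case: pselect => [e|_]; last by rewrite mulr0 addr0.
by rewrite mulrA -mulrDl.
Qed.

Hypothesis h1 : forall a t, `|h a t| <= 1.

Lemma glue_le (x : kappa -> R) (M : R) (t : K) :
  0 <= M -> (forall a, U a t -> `|x a| <= M) -> `|glue x t| <= M.
Proof.
move=> M0 xM; have [[a Uat]|/forallNP nU] := pselect (exists a, U a t).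
  rewrite (glue_in _ _ _ Uat) normrM -[M]mulr1.
  by apply: ler_pM; rewrite ?normr_ge0 ?h1 ?xM.
by rewrite glue_out// normr0.
Qed.

(** Near a point of [U a] the function is [x a * h a]. At any other point, only finitely many [U a]
    carry a coefficient above [e]; their union is closed, and off it the values are at most [e]. *)
Lemma glue_continuous (x : kappa -> R) :
  (forall a, clopen (U a)) -> (forall a, continuous (h a)) ->
  x \in @c0_pred R kappa -> continuous (glue x).
Proof.
move=> clU ch; rewrite inE => /= cx t.
have [[a Uat]|/forallNP nU] := pselect (exists a, U a t).
  rewrite /continuous_at (glue_in _ _ _ Uat).
  have nUa : nbhs t (U a) by apply: open_nbhs_nbhs; split=> //; have [] := clU a.
  apply: (cvg_trans (G := (fun s => x a * h a s) @ t)); last first.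
    by apply: cvgMr; exact: ch.
  by apply: near_eq_cvg; apply: filterS nUa => s /glue_in ->.
rewrite /continuous_at glue_out//; apply/cvgrPdist_le => e e0.
have cD : closed (\bigcup_(a in [set a | e < `|x a|]) U a).
  rewrite -(bigcup_image _ U id); apply: closed_bigcup => [|_ [a _ <-]].
    exact/finite_image/cx.
  by have [] := clU a.
have nD : (~` \bigcup_(a in [set a | e < `|x a|]) U a) t by move=> [a _ /nU].
apply: filterS (open_nbhs_nbhs (conj (closed_openC cD) nD)) => s nDs.
rewrite sub0r normrN; apply: glue_le => [|a Uas]; first exact: ltW.
by rewrite leNgt; apply/negP => xa; apply: nDs; exists a.
Qed.

End glue.

(** * Enumerating the support of an element of c_0 *)

Lemma c0_enum (R : realType) (kappa : Type) (x : c0 R kappa) :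
  exists2 c : nat -> R, c @ \oo --> (0 : R) &
    range c `|` [set 0] = range x `|` [set 0].
Proof.
have := c0P x; rewrite inE => /= cx.
have cS : countable [set a | x a != 0].
  have -> : [set a | x a != 0] = \bigcup_n [set a | n.+1%:R^-1 < `|x a|].
    apply/seteqP; split=> [a /= xa|a [n _ /= xa]]; last first.
      by rewrite -normr_gt0 (lt_trans _ xa)// invr_gt0.
    have xa0 : 0 < `|x a| by rewrite normr_gt0.
    have [n _ /(_ n (leqnn n)) nxa] := near_infty_natSinv_lt (PosNum xa0).
    by exists n.
  apply: bigcup_countable => // n _; apply: finite_set_countable.
  by apply: cx; rewrite invr_gt0.
have /countable_injP[e inje] := cS.
(* Indices outside the image of the support under [e] get the value 0; adjoining 0 to both ranges
   absorbs this padding. *)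
pose c n := if pselect (exists2 a, x a != 0 & e a = n) is left H
            then x (s2val (cid2 H)) else 0.
have cE a : x a != 0 -> c (e a) = x a.
  move=> xa; rewrite /c; case: pselect => [H|[]]; last by exists a.
  case: (cid2 H) => b /= xb eb; congr (x _).
  by apply: inje eb; rewrite inE.
have cV n : c n = 0 \/ exists2 a, x a != 0 & n = e a.
  rewrite /c; case: pselect => [H|_]; last by left.
  by right; case: (cid2 H) => b /= xb eb; exists b.
exists c.
  apply/cvgrPdist_le => d d0.
  have /(finite_image e)/finite_seqP[s Es] := cx d d0.
  (* Beyond the largest [e a] with [d < |x a|], all terms are at most [d] in modulus. *)
  exists (\max_(i <- s) i).+1 => // n /= sn; rewrite sub0r normrN.
  have [->|[a xa en]] := cV n; first by rewrite normr0 ltW.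
  rewrite en cE// leNgt; apply: contraTN sn => dxa.
  have : (e @` [set a | d < `|x a|]) n by rewrite en; exists a.
  by rewrite Es -leqNgt => ns; exact: leq_bigmax_seq.
apply/seteqP; split=> r [|r0]; try by right.
- move=> [n _ <-]; have [->|[a xa ->]] := cV n; first by right.
  by left; exists a => //; rewrite cE.
- move=> [a _ <-]; have [xa|xa] := eqVneq (x a) 0; first by right.
  by left; exists (e a) => //; rewrite cE.
Qed.

(** * The isometric embedding into C(K) *)

Section embedding.
Context (R : realType) (K : topologicalType) (cK : compact [set: K]).
Context (kappa : Type) (U : kappa -> set K) (h : kappa -> K -> R).
Hypotheses (U_disj : forall a b : kappa, a <> b -> U a `&` U b = set0)
  (U_clopen : forall a : kappa, clopen (U a))
  (ch : forall a, continuous (h a)) (h1 : forall a t, `|h a t| <= 1).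

Lemma glue_contfun (x : c0 R kappa) :
  glue (U := U) h x \in @continuous_pred R K.
Proof. by rewrite inE; apply: glue_continuous => //; exact: c0P. Qed.

Lemma glue_isometry : (forall a, exists2 t, U a t & `|h a t| = 1) ->
  exists T : {linear c0 R kappa -> contfun R cK},
    (forall x, `|T x| = `|x|) /\ (forall x, T x = glue (U := U) h x :> (K -> R)).
Proof.
move=> hmax; pose f (x : c0 R kappa) : contfun R cK := ContFun cK (glue_contfun x).
have fl : linear f.
  move=> c x y; apply: val_inj; apply/funext => t; exact: glue_linear.
pose T : {linear c0 R kappa -> contfun R cK} := HB.pack f
  (GRing.isLinear.Build _ _ _ _ f fl).
exists T; split=> // x; apply/eqP; rewrite eq_le; apply/andP; split.
  apply: supnorm_le; first exact/supnorm_ge0/c0_bounded.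
  move=> t; apply: glue_le => // a _.
  exact/supnorm_ub/c0_bounded.
apply: supnorm_le; first exact/supnorm_ge0/contfun_bounded.
(* Where [|h a|] equals 1 on [U a], the image of [x] has modulus [|x a|]. *)
move=> a; have [t Uat ht] := hmax a.
rewrite -[leLHS]mulr1 -ht -normrM -(glue_in _ U_disj _ _ _ Uat).
exact: (supnorm_ub t (contfun_bounded (T x))).
Qed.

End embedding.

Theorem theorem8 (R : realType) (K : topologicalType) (cK : compact [set: K])
  (kappa : Type) (U : kappa -> set K)
  (U_disj : forall a b : kappa, a <> b -> U a `&` U b = set0)
  (U_neq0 : forall a : kappa, U a !=set0)
  (U_clopen : forall a : kappa, clopen (U a))
  (U_scheme : forall a : kappa, admits_clopen_cantor_scheme (U a))
  (PP : set (set R))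
  (PP_compact : forall Q : set R, PP Q -> compact Q)
  (PP_0 : ~ PP [set 0])
  (PP_seq : exists P : set R, PP P /\
     forall c : nat -> R, (exists n : nat, c n <> 0) -> c @ \oo --> (0 : R) ->
       PP ((\bigcup_(i in [set: nat]) [set c i * p | p in P]) `|` [set 0])) :
  exists S : set (contfun R cK),
    isometric_copy (c0 R kappa) S /\
    S `<=` [set f : contfun R cK | PP (range f)] `|` [set 0].
Proof.
have [P [PPP Pseq]] := PP_seq.
(* Otherwise the null sequence 1, 0, 0, ... would put {0} into [PP]. *)
have [p0 Pp0 p0n0] : exists2 p, P p & p != 0.
  apply: contrapT => P0; apply: PP_0.
  have -> : [set 0 : R] =
      (\bigcup_(i in [set: nat]) [set (i == 0%N)%:R * p | p in P]) `|` [set 0].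
    apply/seteqP; split=> [r ->|r [[i _ [p Pp <-]]|->//]]; first by right.
    have [->|p_neq0] := eqVneq p 0; first by rewrite mulr0.
    by case: P0; exists p.
  apply: Pseq; first by exists 0%N => /eqP; rewrite oner_eq0.
  apply: cvg_near_cst; exists 1%N => // -[]//.
have [M PM Mmax] : exists2 M, P M & forall p, P p -> `|p| <= `|M|.
  have [||M] := @compact_EVT_max R R (fun p => `|p|) P _ (PP_compact _ PPP).
  - by exists p0.
  - by apply: continuous_subspaceT => r; exact: norm_continuous.
  by rewrite inE => PM Mmax; exists M => // p Pp; apply: Mmax; rewrite inE.
have M0 : M != 0 by rewrite -normr_gt0 (lt_le_trans _ (Mmax _ Pp0))// normr_gt0.
(* 0 is added to P because K may be the union of finitely many U_a, in which case
   no point outside the U_a takes the value 0. *)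
pose Q := [set M^-1 * p | p in P `|` [set 0]].
have cQ : compact Q.
  apply: continuous_compact; last first.
    by apply: compactU; [exact: PP_compact|exact: compact_set1].
  by apply: continuous_subspaceT => r; exact: mulrl_continuous.
have Q1 q : Q q -> `|q| <= 1.
  move=> [p Pp <-]; rewrite normrM normfV ler_pdivrMl ?normr_gt0// mulr1.
  by case: Pp => [/Mmax//|->]; rewrite normr0.
have Q0 : Q 0 by exists 0; [right|rewrite mulr0].
have QM : Q 1 by exists M; [left|rewrite mulVf].
have /choice[h hP] a : exists f : K -> R,
    [/\ continuous f, forall t, Q (f t) & Q `<=` f @` U a].
  by apply: scheme_onto_compact => //; exists 0.
have ch a : continuous (h a) by have [] := hP a.
have hQ a t : Q (h a t) by have [] := hP a.
have Qh a q : Q q -> exists2 t, U a t & h a t = q.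
  by have [_ _ /[apply] -[t]] := hP a; exists t.
have h1 a t : `|h a t| <= 1 by exact: Q1.
have hmax a : exists2 t, U a t & `|h a t| = 1.
  by have [t Ut ht] := Qh a 1 QM; exists t; rewrite ?ht ?normr1.
have [T [Tn Tx]] := @glue_isometry R K cK kappa U h U_disj U_clopen ch h1 hmax.
exists (range T); split; first by exists T.
move=> _ [x _ <-]; have [->|x0] := eqVneq x 0; [right; exact: linear0|left].
(* This index serves twice: [U a] supplies a point where the image vanishes, and [x a] makes the
   enumerating sequence non-zero. *)
have [a xa] : exists a, x a != 0.
  apply: contrapT => /forallNP nx; move/eqP: x0; apply; apply: val_inj.
  by apply/funext => a; apply/eqP/negPn/negP/nx.
have [c c0 cx] := @c0_enum R kappa x.
(* The factor [M^-1] is moved from [Q] into the sequence, leaving multiples of [P] itself. *)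
have rT : range (T x) =
    \bigcup_(i in [set: nat]) [set (M^-1 * c i) * p | p in P] `|` [set 0].
  rewrite Tx; apply/seteqP; split=> [_ [t _ <-]|r].
    have [[b Ub]|/forallNP nU] := pselect (exists b, U b t); last first.
      by right; rewrite glue_out.
    rewrite (glue_in _ U_disj _ _ _ Ub).
    have [p [Pp|->] <-] := hQ b t; last by right; rewrite !mulr0.
    have : (range c `|` [set 0]) (x b) by rewrite cx; left; exists b.
    move=> [[i _ <-]|->]; last by right; rewrite mul0r.
    by left; exists i => //; exists p => //; rewrite mulrCA mulrA.
  move=> [[i _ [p Pp <-]]|->]; last first.
    have [t Ut ht] := Qh a 0 Q0.
    by exists t => //; rewrite (glue_in _ U_disj _ _ _ Ut) ht mulr0.
  have : (range x `|` [set 0]) (c i) by rewrite -cx; left; exists i.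
  have Qp : Q (M^-1 * p) by exists p; [left|].
  move=> [[b _ <-]|->].
    have [t Ut ht] := Qh b _ Qp; exists t => //.
    by rewrite (glue_in _ U_disj _ _ _ Ut) ht mulrCA mulrA.
  (* A term [c i = 0] contributes only the value 0, which is attained on [U a]. *)
  have [t Ut ht] := Qh a 0 Q0.
  by exists t => //; rewrite (glue_in _ U_disj _ _ _ Ut) ht !mulr0 mul0r.
rewrite /= rT; apply: Pseq.
  have : (range c `|` [set 0]) (x a) by rewrite cx; left; exists a.
  move=> [[n _ cn]|xa0]; last by rewrite xa0 eqxx in xa.
  by exists n; apply/eqP; rewrite mulf_neq0 ?invr_eq0 ?cn.
by rewrite -[0 in X in _ --> X](mulr0 M^-1); apply: cvgMr.
Qed.
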